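(* Let $\{A_0,\ldots,A_d\}$ be an association scheme whose set of minimal idempotents is given by $\{E_0,\ldots,E_d\}$. Assume one of its classes is a permutation matrix of order two, say $A_q$ for some $q$, with spectral decomposition $A_q=\sum_{s=0}^d\sigma_sE_s$. Let $X$ be a graph in this scheme, with integer eigenvalues $\theta_0\ge\cdots\ge\theta_d$. Define $$g=\gcd\{\theta_0-\theta_s\}_{s=1}^d.$$ Then for all integers $m\ge1$ satisfying the properties (i) $\{(\theta_0-\theta_s)/g\}_{\sigma_s=-1}$ are all congruent to the same integer $\mu$ modulo $m$, and (ii) $\{(\theta_0-\theta_s)/g\}_{\sigma_s=1}$ are all congruent to $0$ modulo $m$, it follows that $X$ admits $e^{\mathrm{i}\zeta}(\alpha,\beta)$ fractional revival at time $\tau=2t\pi/(mg)$, for any integer $t$, where $$\zeta=t\pi\left(\frac{-2\theta_0-\mu g}{mg}\right),\qquad\alpha=\cos\left(\frac{t\mu\pi}{m}\right)\qquad\text{and}\qquad\beta=\mathrm{i}\sin\left(\frac{t\mu\pi}{m}\right).$$ Moreover, if fractional revival occurs at time $\tau$, then there are integers $m$ and $\mu$ such that (i) and (ii) above hold.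
   Context: A (symmetric) association scheme is a set of $n\times n$ symmetric $01$-matrices $\{A_0,\ldots,A_d\}$ (its classes) with $A_0=I$, $\sum_iA_i=J$ (the all-ones matrix), and every product $A_iA_j$ a linear combination of $A_0,\ldots,A_d$. The $A_i$ span a commutative algebra (the Bose-Mesner algebra), which also has a basis $E_0,\ldots,E_d$ of minimal idempotents, the orthogonal projections onto the common eigenspaces; $E_0=\frac1nJ$. A graph $X$ is in the scheme if its adjacency matrix $A$ is a sum of some of the classes; $\theta_s$ is the eigenvalue of $A$ on $E_s$, i.e. $A=\sum_s\theta_sE_s$. With $U(t)=e^{-\mathrm{i}tA}$, $X$ has $e^{\mathrm{i}\zeta}(\alpha,\beta)$ fractional revival from a vertex $a$ to a vertex $b\neq a$ at time $\tau$ if $U(\tau)\mathbf{e}_a=e^{\mathrm{i}\zeta}(\alpha\mathbf{e}_a+\beta\mathbf{e}_b)$ with $|\alpha|^2+|\beta|^2=1$ and $\beta\neq0$, where $\mathbf{e}_a$ is the standard basis vector indexed by $a$; in the theorem this is between the pairs $a,b$ with $(A_q)_{a,b}=1$. If $\mu=0$, the first part of the theorem describes periodicity ($\beta=0$).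
   Formalization: The printed signs fail (e.g. K_2, m=4, t=1), so μ is replaced by −μ in ζ and β: ζ=tπ(−2θ_0+μg)/(mg), β=−i sin(tμπ/m); β≠0 is claimed only when m does not divide tμ (otherwise periodicity), and g≠0 is assumed. *)

(* Defs.v *)
From HB Require Import structures.
From mathcomp Require Import all_boot all_order all_algebra all_fingroup.
From mathcomp Require Import all_classical all_reals all_analysis.
From mathcomp Require Export complex.

Set Implicit Arguments.
Unset Strict Implicit.
Unset Printing Implicit Defensive.

Import Order.TTheory GRing.Theory Num.Theory.
Import numFieldNormedType.Exports.

Local Open Scope classical_set_scope.
Local Open Scope complex_scope.
Local Open Scope ring_scope.

Section Scheme.
Variables (F : fieldType) (n d : nat).
Implicit Types (A E : 'I_d.+1 -> 'M[F]_n) (M : 'M[F]_n).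

Definition bose_mesner A M : Prop :=
  exists c : 'I_d.+1 -> F, M = \sum_i c i *: A i.

(* The nonzero 01-matrices A i sum to J, so they are linearly independent:
   they form a basis, of size d.+1, of the Bose-Mesner algebra. *)
Record assoc_scheme A : Prop := AssocScheme {
  scheme_01 : forall i x y, A i x y = 0 \/ A i x y = 1;
  scheme_neq0 : forall i, A i <> 0;
  scheme_sym : forall i, (A i)^T = A i;
  scheme_id : A ord0 = 1%:M;
  scheme_sum : \sum_i A i = const_mx 1;
  scheme_mul : forall i j, bose_mesner A (A i *m A j) }.

Record minimal_idempotent A M : Prop := MinimalIdempotent {
  min_idem_mem : bose_mesner A M;
  min_idem_idem : M *m M = M;
  min_idem_neq0 : M <> 0;
  min_idem_min : forall N, bose_mesner A N -> N *m N = N -> N *m M = N ->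
    N = 0 \/ N = M }.

Record minimal_idempotents A E : Prop := MinimalIdempotents {
  min_idems_inj : injective E;
  min_idemsP : forall M, minimal_idempotent A M <-> exists s, M = E s;
  min_idems0 : E ord0 = const_mx (n%:R^-1) }.

Definition simple_graph (X : rel 'I_n) : Prop :=
  symmetric X /\ irreflexive X.

Definition adjmx (X : rel 'I_n) : 'M[F]_n := \matrix_(x, y) (X x y)%:R.

Definition graph_in_scheme A (X : rel 'I_n) : Prop :=
  exists S : {set 'I_d.+1}, adjmx X = \sum_(i in S) A i.

End Scheme.

Arguments adjmx F {n} X.

Section Eigenvalues.
Variable d : nat.
Implicit Types theta : 'I_d.+1 -> int.

Definition eigen_gcd theta : nat :=
  \big[gcdn/0]_(s < d.+1 | s != ord0) `|theta ord0 - theta s|%N.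

(* The division is exact. *)
Definition scaled_gap theta (s : 'I_d.+1) : int :=
  ((theta ord0 - theta s) %/ (eigen_gcd theta)%:Z)%Z.

Definition cond_i (F : fieldType) theta (sigma : 'I_d.+1 -> F) (m mu : int) :=
  forall s, sigma s = -1 -> (scaled_gap theta s = mu %[mod m])%Z.

Definition cond_ii (F : fieldType) theta (sigma : 'I_d.+1 -> F) (m : int) :=
  forall s, sigma s = 1 -> (scaled_gap theta s = 0 %[mod m])%Z.

End Eigenvalues.

Definition expmx (C : numFieldType) (n : nat) (M : 'M[C]_n) : 'M[C]_n :=
  lim ((fun N : nat => \sum_(k < N) (k`!%:R)^-1 *: M ^+ k) @ \oo).

Section Walk.
Variables (R : realType) (n : nat).
Implicit Types (A : 'M[R[i]]_n) (t zeta : R) (alpha beta : R[i]) (a b : 'I_n).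

Definition walk A t : 'M[R[i]]_n := expmx (- ('i * t%:C) *: A).

Definition expi (x : R) : R[i] := cos x +i* sin x.

Definition basis_vec a : 'cV[R[i]]_n := delta_mx a ord0.

(* beta = 0, that is periodicity at a, is allowed here. *)
Definition revival A t zeta alpha beta a b : Prop :=
  walk A t *m basis_vec a =
    expi zeta *: (alpha *: basis_vec a + beta *: basis_vec b) /\
  `|alpha| ^+ 2 + `|beta| ^+ 2 = 1.

Definition fractional_revival A t zeta alpha beta a b : Prop :=
  [/\ a <> b, revival A t zeta alpha beta a b & beta <> 0].

End Walk.

Section RevivalData.
Variables (R : realType) (g : nat) (theta0 m mu t : int).

Definition revival_time : R := 2 * t%:~R * pi / (m%:~R * g%:R).

(* With U(t) = exp (- i t A) and mu the residue of (theta_0 - theta_s) / g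
   where sigma_s = -1, the eigenvalue of U on E_s at the revival time is
     exp (- i tau theta_0)                     if sigma_s = 1,
     exp (- i tau theta_0 + 2 i t mu pi / m)   if sigma_s = -1,
   and equals exp (i zeta) (alpha + beta sigma_s).  This forces the signs of
   mu in zeta and in beta, up to the choice of a common phase. *)
Definition revival_zeta : R :=
  t%:~R * pi * ((- 2 * theta0%:~R + mu%:~R * g%:R) / (m%:~R * g%:R)).

Definition revival_alpha : R[i] := (cos (t%:~R * mu%:~R * pi / m%:~R))%:C.

Definition revival_beta : R[i] :=
  - ('i * (sin (t%:~R * mu%:~R * pi / m%:~R))%:C).

End RevivalData.

(* Main.v *)
(* Let tau be a time, U = exp (- i tau A) the walk matrix and
   gamma_s = (theta_0 - theta_s) / g.  A matrix of the Bose-Mesner algebra is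
   determined by any of its columns, so revival from a to b means that U and
   e^(i zeta) (alpha I + beta A_q) agree, i.e. have the same eigenvalue on
   every E_s, and sigma_s = 1 or -1.  This says that
   e^(i tau g gamma_s) is 1 where sigma_s = 1 and takes a common value,
   different from 1 if beta <> 0, where sigma_s = -1.  Conversely, given such
   a revival, fix r with sigma_r = -1 and let mu = gamma_r.  The gcd m of the
   gamma_s with sigma_s = 1 and the gamma_s - mu with sigma_s = -1 satisfies
   e^(i tau g m) = 1 by Bezout, which determines tau.  If m = 0, then A is a
   combination of I and A_q, hence A = A_q, and any modulus not dividing mu
   will do. *)
Require Import Defs.
From HB Require Import structures.
From mathcomp Require Import all_boot all_order all_algebra all_fingroup.
From mathcomp Require Import all_classical all_reals all_analysis.
From mathcomp Require Import complex ring lra zify.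
Import Order.TTheory GRing.Theory Num.Theory.
Import numFieldNormedType.Exports.
Local Open Scope classical_set_scope.
Local Open Scope ring_scope.

Set Implicit Arguments.
Unset Strict Implicit.
Unset Printing Implicit Defensive.

(** * The Bose-Mesner algebra and its basis of minimal idempotents *)

Section BoseMesner.
Variables (F : fieldType) (n d : nat) (A : 'I_d.+1 -> 'M[F]_n).
Hypothesis schemeA : assoc_scheme A.

Lemma bose_mesner_class i : bose_mesner A (A i).
Proof.
exists (fun j => (j == i)%:R); rewrite (bigD1 i)//= eqxx scale1r big1 ?addr0//.
by move=> j /negbTE->; rewrite scale0r.
Qed.

Lemma bose_mesnerZ c M : bose_mesner A M -> bose_mesner A (c *: M).
Proof.
move=> [m ->]; exists (fun i => c * m i); rewrite scaler_sumr.
by apply: eq_bigr => i _; rewrite scalerA.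
Qed.

Lemma bose_mesnerD M N :
  bose_mesner A M -> bose_mesner A N -> bose_mesner A (M + N).
Proof.
move=> [m ->] [k ->]; exists (fun i => m i + k i); rewrite -big_split/=.
by apply: eq_bigr => i _; rewrite scalerDl.
Qed.

Lemma bose_mesner_sum (I : finType) (G : I -> 'M[F]_n) :
  (forall i, bose_mesner A (G i)) -> bose_mesner A (\sum_i G i).
Proof.
move=> AG; apply: (big_ind (bose_mesner A)) => //; last exact: bose_mesnerD.
by exists (fun=> 0); rewrite big1// => i _; rewrite scale0r.
Qed.

Lemma bose_mesnerM M N :
  bose_mesner A M -> bose_mesner A N -> bose_mesner A (M *m N).
Proof.
move=> [m ->] [k ->]; rewrite mulmx_suml; apply: bose_mesner_sum => i.
rewrite mulmx_sumr; apply: bose_mesner_sum => j.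
by rewrite -scalemxAl -scalemxAr; do 2! apply: bose_mesnerZ; apply: scheme_mul.
Qed.

Lemma bose_mesner1 : bose_mesner A 1%:M.
Proof. by rewrite -(scheme_id schemeA); apply: bose_mesner_class. Qed.

Lemma bose_mesner_tr M : bose_mesner A M -> M^T = M.
Proof.
move=> [m ->]; rewrite linear_sum; apply: eq_bigr => i _ /=.
by rewrite linearZ/= scheme_sym.
Qed.

(** The product lies in the algebra, so it is symmetric, and its transpose is the product in the
    other order. *)
Lemma bose_mesnerC M N :
  bose_mesner A M -> bose_mesner A N -> M *m N = N *m M.
Proof.
move=> AM AN; rewrite -(bose_mesner_tr (bose_mesnerM AM AN)) trmx_mul.
by rewrite !bose_mesner_tr.
Qed.

Variable E : 'I_d.+1 -> 'M[F]_n.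
Hypothesis idemE : minimal_idempotents A E.

Lemma min_idemE s : minimal_idempotent A (E s).
Proof. by apply/(min_idemsP idemE); exists s. Qed.

(** The product is an idempotent below both [E r] and [E s]. By minimality it is 0 or equal to both,
    and the latter contradicts injectivity of [E]. *)
Lemma min_idems_orth r s : r != s -> E r *m E s = 0.
Proof.
move=> nrs; have [Er Es] := (min_idemE r, min_idemE s).
have [Ar As] := (min_idem_mem Er, min_idem_mem Es).
have idr := min_idem_idem Er; have ids := min_idem_idem Es.
have cEE := bose_mesnerC Ar As.
have id1 : (E r *m E s) *m E s = E r *m E s by rewrite -mulmxA ids.
have id2 : (E r *m E s) *m E r = E r *m E s by rewrite -mulmxA -cEE mulmxA idr.
have id3 : (E r *m E s) *m (E r *m E s) = E r *m E s by rewrite mulmxA id2.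
case: (min_idem_min Er (bose_mesnerM Ar As) id3 id2) => // e1.
case: (min_idem_min Es (bose_mesnerM Ar As) id3 id1) => // e2.
move/eqP: nrs => []; apply: (min_idems_inj idemE).
exact: etrans (esym e1) e2.
Qed.

Lemma min_idems_mul r s : E r *m E s = (r == s)%:R *: E s.
Proof.
case: eqVneq => [->|/min_idems_orth->]; last by rewrite scale0r.
by rewrite scale1r (min_idem_idem (min_idemE s)).
Qed.

Lemma sum_min_idems_mulr (c : 'I_d.+1 -> F) s :
  (\sum_r c r *: E r) *m E s = c s *: E s.
Proof.
rewrite mulmx_suml (bigD1 s)//= big1 => [|r nrs].
  by rewrite addr0 -scalemxAl min_idems_mul eqxx scale1r.
by rewrite -scalemxAl min_idems_orth// scaler0.
Qed.

Lemma sum_min_idems_inj (c c' : 'I_d.+1 -> F) :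
  \sum_s c s *: E s = \sum_s c' s *: E s -> c =1 c'.
Proof.
move=> eqc s; have := congr1 (mulmx^~ (E s)) eqc.
rewrite /= !sum_min_idems_mulr => /eqP.
rewrite -subr_eq0 -scalerBl scaler_eq0 subr_eq0 => /orP[/eqP//|/eqP Es0].
by have := min_idem_neq0 (min_idemE s).
Qed.

Lemma sum_min_idems_mul (c c' : 'I_d.+1 -> F) :
  (\sum_s c s *: E s) *m (\sum_s c' s *: E s) = \sum_s (c s * c' s) *: E s.
Proof.
rewrite mulmx_sumr; apply: eq_bigr => s _.
by rewrite -scalemxAr sum_min_idems_mulr scalerA mulrC.
Qed.

(* The E s are linearly independent and as many as the A i. *)
Lemma bose_mesner_spectral M :
  bose_mesner A M -> exists c : 'I_d.+1 -> F, M = \sum_s c s *: E s.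
Proof.
have /choice[P EP] : forall s, exists c : 'I_d.+1 -> F, E s = \sum_i c i *: A i.
  by move=> s; exact: min_idem_mem (min_idemE s).
pose Q : 'M[F]_d.+1 := \matrix_(s, i) P s i.
have Qunit : Q \in unitmx.
  (* A row [u] with [u *m Q = 0] is a linear relation between the [E s], hence zero. *)
  rewrite -row_free_unit -kermx_eq0; apply/eqP/row_matrixP => k; rewrite row0.
  set u := row k _.
  have uQ : u *m Q = 0 by rewrite /u -row_mul mulmx_ker row0.
  have : \sum_s u 0 s *: E s = \sum_s 0 *: E s.
    rewrite [RHS]big1 => [|s _]; last by rewrite scale0r.
    transitivity (\sum_i (u *m Q) 0 i *: A i); last first.
      by rewrite uQ big1// => i _; rewrite mxE scale0r.
    under eq_bigr do rewrite EP scaler_sumr.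
    rewrite exchange_big /=; apply: eq_bigr => i _; rewrite mxE scaler_suml.
    by apply: eq_bigr => s _; rewrite [Q _ _]mxE scalerA.
  by move=> /sum_min_idems_inj u0; apply/rowP => s; rewrite u0 mxE.
(* Since [Q] expresses the [E s] in the classes, the inverse of [Q] turns class coordinates into
   idempotent coordinates. *)
move=> [c ->]; pose w := \row_i c i *m invmx Q.
exists (w 0); under [RHS]eq_bigr do rewrite EP scaler_sumr.
rewrite exchange_big /=; apply: eq_bigr => i _.
transitivity ((w *m Q) 0 i *: A i); first by rewrite /w mulmxKV// mxE.
rewrite mxE scaler_suml; apply: eq_bigr => s _.
by rewrite [Q _ _]mxE scalerA.
Qed.

(** Expand the identity in the [E s] and multiply by [E s]: the coefficient must be 1 because [E s]
    is nonzero. *)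
Lemma sum_min_idems : \sum_s E s = 1%:M.
Proof.
have [c Ic] := bose_mesner_spectral bose_mesner1.
rewrite Ic; apply: eq_bigr => s _; suff -> : c s = 1 by rewrite scale1r.
have : c s *: E s = 1 *: E s.
  by rewrite -sum_min_idems_mulr -Ic mul1mx scale1r.
move/eqP; rewrite -subr_eq0 -scalerBl scaler_eq0 subr_eq0 => /orP[/eqP//|].
by move/eqP; have := min_idem_neq0 (min_idemE s).
Qed.

Lemma sum_min_idems_exp (c : 'I_d.+1 -> F) k :
  (\sum_s c s *: E s) ^+ k = \sum_s c s ^+ k *: E s.
Proof.
elim: k => [|k IHk].
  rewrite expr0 -[LHS]sum_min_idems.
  by apply: eq_bigr => s _; rewrite expr0 scale1r.
rewrite exprS IHk -[LHS]/(_ *m _) sum_min_idems_mul.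
by apply: eq_bigr => s _; rewrite exprS.
Qed.

End BoseMesner.

(** * Entries, row sums and columns of matrices in the algebra *)

Section SchemeEntries.
Variables (F : numFieldType) (n d : nat) (A E : 'I_d.+1 -> 'M[F]_n).
Hypotheses (schemeA : assoc_scheme A) (idemE : minimal_idempotents A E).

Lemma scheme_ge0 i x y : 0 <= A i x y.
Proof. by have [->|->] := scheme_01 schemeA i x y. Qed.

(* The classes are 01-matrices with sum J. *)
Lemma scheme_entry i j x y : A i x y = 1 -> j != i -> A j x y = 0.
Proof.
move=> Ai1 nji; have := congr1 (fun M : 'M[F]_n => M x y) (scheme_sum schemeA).
rewrite /= summxE mxE (bigD1 i)//= Ai1 -[RHS]addr0 => /addrI/eqP.
rewrite psumr_eq0; last by move=> k _; exact: scheme_ge0.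
by move=> /allP/(_ j); rewrite mem_index_enum nji /= => /(_ isT)/eqP.
Qed.

Lemma scheme_diag i a : i != ord0 -> A i a a = 0.
Proof. by apply: scheme_entry; rewrite (scheme_id schemeA) mxE eqxx. Qed.

(* M commutes with E_0 = J / n, which spans the eigenspace of a single
   eigenvalue of M. *)
Lemma bose_mesner_rowsum M :
  bose_mesner A M -> exists k, forall x, \sum_y M x y = k.
Proof.
move=> /(bose_mesner_spectral schemeA idemE)[c Mc]; exists (c ord0) => x.
have n0 : n%:R != 0 :> F by rewrite pnatr_eq0; case: (n) x => // -[].
have := sum_min_idems_mulr schemeA idemE c ord0; rewrite -Mc (min_idems0 idemE).
(* At the entry [x x], the identity M E_0 = c_0 E_0 says that the sum of row [x], divided by n, is
   c_0 / n. *)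
move=> /(congr1 (fun N : 'M[F]_n => N x x)); rewrite !mxE.
under eq_bigr do rewrite mxE.
by rewrite -mulr_suml => /(mulIf (invr_neq0 n0)).
Qed.

(** A zero row would make the constant row sum 0; the entries being nonnegative, the whole class
    would vanish. *)
Lemma scheme_row_neq0 i a : exists x, A i a x = 1.
Proof.
apply: contrapT => noA; have Aa0 x : A i a x = 0.
  by have [//|Ai1] := scheme_01 schemeA i a x; case: noA; exists x.
apply: (scheme_neq0 schemeA (i := i)); apply/matrixP => x y; rewrite mxE.
have [k Ak] := bose_mesner_rowsum (bose_mesner_class A i).
have : \sum_z A i x z = 0 by rewrite Ak -(Ak a) big1.
move=> /eqP; rewrite psumr_eq0; last by move=> z _; exact: scheme_ge0.
by move=> /allP/(_ y); rewrite mem_index_enum => /(_ isT)/eqP.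
Qed.

(* The coefficient of A i in M can be read off any column of M. *)
Lemma bose_mesner_col_eq0 M a :
  bose_mesner A M -> M *m delta_mx a (ord0 : 'I_1) = 0 -> M = 0.
Proof.
move=> [c Mc] Ma; rewrite Mc big1// => i _.
suff -> : c i = 0 by rewrite scale0r.
have [x Aiax] := scheme_row_neq0 i a.
have Aixa : A i x a = 1 by rewrite -(scheme_sym schemeA) mxE.
move/colP: Ma => /(_ x); rewrite -colE !mxE Mc summxE (bigD1 i)//= big1.
  by rewrite addr0 mxE Aixa mulr1.
by move=> j nji; rewrite mxE (scheme_entry Aixa nji) mulr0.
Qed.

(** The difference of the two matrices is in the algebra and has a zero column, so it is 0. This
    turns a statement about one vertex into one about all eigenvalues. *)
Lemma sum_min_idems_col (c c' : 'I_d.+1 -> F) a :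
  (\sum_s c s *: E s) *m delta_mx a (ord0 : 'I_1) =
    (\sum_s c' s *: E s) *m delta_mx a (ord0 : 'I_1) -> c =1 c'.
Proof.
move=> eqca; apply: (sum_min_idems_inj schemeA idemE); apply/eqP.
rewrite -subr_eq0; apply/eqP; apply: (@bose_mesner_col_eq0 _ a); last first.
  by rewrite mulmxBl eqca subrr.
rewrite -sumrB; apply: bose_mesner_sum => s; rewrite -scalerBl.
by apply: bose_mesnerZ; exact: min_idem_mem (min_idemE idemE s).
Qed.

(** * A class that is a permutation matrix of order two *)

Section PermutationClass.
Variables (q : 'I_d.+1) (p : 'S_n) (sigma : 'I_d.+1 -> F).
Hypotheses (Aq : A q = perm_mx p) (ordp : #[p]%g = 2%N).
Hypothesis Asigma : A q = \sum_s sigma s *: E s.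

Lemma perm_class_neq1 : A q <> 1%:M.
Proof.
rewrite Aq -perm_mx1 => eqp1; have p1 : p = 1%g.
  apply/permP => x; rewrite perm1; apply/eqP.
  move/matrixP: eqp1 => /(_ x (p x)); rewrite !mxE perm1 eqxx.
  by case: eqVneq => // _ /eqP; rewrite oner_eq0.
by move: ordp; rewrite p1 order1.
Qed.

Lemma perm_class_diag a : A q a a = 0.
Proof.
apply: scheme_diag; apply/eqP => q0; apply: perm_class_neq1.
by rewrite q0 (scheme_id schemeA).
Qed.

Lemma perm_class_basis a b :
  A q a b = 1 -> A q *m delta_mx a (ord0 : 'I_1) = delta_mx b ord0.
Proof.
move=> Aqab; rewrite -colE; apply/colP => x; rewrite !mxE.
(* By symmetry, column [a] is row [a], whose only nonzero entry is the one at [b]. *)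
have -> : A q x a = A q a x by rewrite -{1}(scheme_sym schemeA) mxE.
move: Aqab; rewrite Aq !mxE andbT eq_sym [x == b]eq_sym.
by case: eqVneq => [->|_ /esym/eqP] //; rewrite oner_eq0.
Qed.

(** As [p] has order two, the square of [A q] is the identity; compare eigenvalues. *)
Lemma sigma_pm1 s : sigma s = 1 \/ sigma s = -1.
Proof.
suff /eqP : sigma s * sigma s = 1.
  by rewrite -expr2 sqrf_eq1 => /orP[]/eqP; [left|right].
apply: (sum_min_idems_inj schemeA idemE (c := fun s => sigma s * sigma s)
  (c' := fun=> 1)).
rewrite -(sum_min_idems_mul schemeA idemE) -Asigma Aq -perm_mxM.
have := expg_order p; rewrite ordp expgS expg1 => ->.
rewrite perm_mx1 -(sum_min_idems schemeA idemE).
by apply: eq_bigr => r _; rewrite scale1r.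
Qed.

(** Permuting the rows of E_0 = J / n does not change it. The vertex [a] ensures that n is
    nonzero. *)
Lemma sigma0 (a : 'I_n) : sigma ord0 = 1.
Proof.
have n0 : n%:R != 0 :> F by rewrite pnatr_eq0; case: (n) a => // -[].
have := sum_min_idems_mulr schemeA idemE sigma ord0.
rewrite -Asigma (min_idems0 idemE) Aq -row_permE.
move=> /(congr1 (fun N : 'M[F]_n => N a a)); rewrite !mxE.
by move=> /esym/(canRL (mulfK (invr_neq0 n0))); rewrite mulfV// invr_eq0.
Qed.

(** If every eigenvalue were 1, [A q] would be the sum of the [E s], that is the identity. *)
Lemma sigma_neg : exists s, sigma s = -1.
Proof.
apply: contrapT => nosigma; apply: perm_class_neq1.
rewrite Asigma -(sum_min_idems schemeA idemE); apply: eq_bigr => s _.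
have [->|sN1] := sigma_pm1 s; first by rewrite scale1r.
by case: nosigma; exists s.
Qed.

(** Both [adjmx F X] and [A q] have zero diagonal, so [x = 0]. At an entry where [A q] is 1, [y]
    equals an entry of a 01-matrix, so it is 1. *)
Lemma affine_perm_class (a : 'I_n) (X : rel 'I_n) (x y : F) :
  irreflexive X -> adjmx F X = x *: 1%:M + y *: A q -> y != 0 ->
  adjmx F X = A q.
Proof.
move=> irrX AX y0; have x0 : x = 0.
  move/matrixP: (AX) => /(_ a a); rewrite !mxE irrX perm_class_diag eqxx.
  by rewrite mulr0 mulr1 addr0.
have AXq : adjmx F X = y *: A q by rewrite AX x0 scale0r add0r.
have [b Aqab] := scheme_row_neq0 q a; suff y1 : y = 1 by rewrite AXq y1 scale1r.
move/matrixP: AXq => /(_ a b); rewrite !mxE Aqab mulr1.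
by case: (X a b) => // /esym/eqP; rewrite (negbTE y0).
Qed.

End PermutationClass.
End SchemeEntries.

(** * Limits, and the matrix exponential computed on each eigenspace *)

Lemma cvgDM_cst (K : numFieldType) (u v : nat -> K) (x a b : K) :
  u @ \oo --> a -> v @ \oo --> b ->
  (fun N => u N + x * v N) @ \oo --> a + x * b.
Proof.
by move=> ua vb; apply: cvgD => //; apply: cvgM => //; exact: cvg_cst.
Qed.

Lemma cvg_sum (K : numFieldType) (V : normedModType K) (I : finType)
    (f : I -> nat -> V) (l : I -> V) :
  (forall i, f i @ \oo --> l i) ->
  (fun N => \sum_i f i N) @ \oo --> \sum_i l i.
Proof.
move=> fl; rewrite -fct_sumE.
elim/big_ind2: _ => [|g a h b ga hb|i _].
- exact: cvg_cst.
- exact: cvgD.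
- exact: fl.
Qed.

Lemma expmx_spectral (C : numFieldType) (n d : nat) (A E : 'I_d.+1 -> 'M[C]_n)
    (c e : 'I_d.+1 -> C) :
  assoc_scheme A -> minimal_idempotents A E ->
  (forall s, (fun N => \sum_(k < N) (k`!%:R)^-1 * c s ^+ k) @ \oo --> e s) ->
  expmx (\sum_s c s *: E s) = \sum_s e s *: E s.
Proof.
case: n A E => [|n] A E schemeA idemE ce.
  (* In dimension 0 both sides are the empty matrix. *)
  by rewrite [LHS]thinmx0 [RHS]thinmx0.
rewrite /expmx; apply: cvg_lim; first exact: norm_hausdorff.
(* Each partial sum of the exponential series is a combination of the [E s] with scalar partial sums
   as coefficients. *)
rewrite [X in X @ _ --> _](_ : _ = fun N : nat =>
    \sum_s (\sum_(k < N) (k`!%:R)^-1 * c s ^+ k) *: E s); last first.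
  apply/funext => N; under eq_bigr do
    rewrite (sum_min_idems_exp schemeA idemE) scaler_sumr.
  rewrite exchange_big /=; apply: eq_bigr => s _; rewrite scaler_suml.
  by apply: eq_bigr => k _; rewrite scalerA.
apply: cvg_sum => s; apply: cvgZ; [exact: ce|exact: cvg_cst].
Qed.

(** * The unit complex numbers [expi x] and their power series *)

Section Expi.
Variable R : realType.
Implicit Types x y : R.
Local Open Scope complex_scope.

Lemma expiD x y : expi (x + y) = expi x * expi y.
Proof.
by rewrite /expi cosD sinD; apply/eqP; rewrite eq_complex /= eqxx addrC eqxx.
Qed.

Lemma expi0 : expi (0 : R) = 1.
Proof. by rewrite /expi cos0 sin0. Qed.

Lemma expi_neq0 x : expi x != 0.
Proof.
apply/eqP => x0; have := expiD x (- x).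
by rewrite subrr expi0 x0 mul0r => /eqP; rewrite oner_eq0.
Qed.

Lemma expiN x : expi (- x) = (expi x)^-1.
Proof.
by apply: (mulIf (expi_neq0 x)); rewrite -expiD addNr expi0 mulVf ?expi_neq0.
Qed.

Lemma expiMz x (k : int) : expi (x * k%:~R) = expi x ^ k.
Proof.
have expiMn m : expi (x * m%:R) = expi x ^+ m.
  elim: m => [|m IHm]; first by rewrite mulr0 expi0.
  by rewrite -natr1 mulrDr mulr1 expiD IHm exprSr.
case: k => m; first exact: expiMn.
by rewrite [in LHS]NegzE mulrNz mulrN expiN (expiMn m.+1).
Qed.

Lemma expi2pi : expi (2 * pi : R) = 1.
Proof. by rewrite /expi mulr_natl cos2pi -[_ *+ 2]add0r sinD2pi sin0. Qed.

(** Reduce [x] modulo 2 pi to [y] in [0, 2 pi). If [y] were nonzero, then sin (y / 2) > 0, so cos y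
    = 1 - 2 sin^2 (y / 2) would be less than 1. *)
Lemma expi_eq1 x : expi x = 1 -> exists k : int, x = 2 * pi * k%:~R.
Proof.
move=> x1; have pi2 : 0 < 2 * pi :> R by rewrite mulr_gt0// pi_gt0.
pose k := Num.floor (x / (2 * pi)); exists k.
pose y := x - 2 * pi * k%:~R.
have y1 : expi y = 1.
  by rewrite /y -mulrN -mulrNz expiD expiMz expi2pi exp1rz mulr1.
have /andP[lek ltk] := floor_itv (x / (2 * pi)).
have y0 : 0 <= y by rewrite subr_ge0 [leLHS]mulrC -ler_pdivlMr.
have y2pi : y < 2 * pi.
  rewrite ltrBlDl -[X in _ + X]mulr1 -mulrDr [ltRHS]mulrC -ltr_pdivrMr//.
  by move: ltk; rewrite intrD.
apply/eqP; rewrite -subr_eq0 -/y; apply: contraT => yn0.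
have : 0 < sin (y / 2).
  have {yn0}y0 : 0 < y by rewrite lt0r yn0.
  by apply: sin_gt0_pi; apply/andP; split; lra.
have := cos_mulr2n (y / 2); rewrite -[_ / _ *+ 2]mulr_natr divfK//.
have -> : cos y = 1 by case: y1.
have := cos2Dsin2 (y / 2); nra.
Qed.

Lemma expi_trig_series y N :
  \sum_(k < N) (k`!%:R)^-1 * ('i * y%:C) ^+ k =
    series (cos_coeff y) N +i* series (sin_coeff y) N.
Proof.
rewrite /series /= !big_mkord.
elim: N => [|N IHN]; first by rewrite !big_ord0.
rewrite !big_ord_recr/= IHN.
(* Powers of i split by parity, in the form of the signs in [cos_coeff] and [sin_coeff]. *)
have iX : ('i : R[i]) ^+ N = ((~~ odd N)%:R * (-1) ^+ N./2) +i*
    ((odd N)%:R * (-1) ^+ N.-1./2).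
  rewrite -{1}(odd_double_half N) addnC exprD -mul2n exprM sqr_i.
  rewrite -[in N.-1./2](odd_double_half N).
  rewrite -(rmorphN1 (real_complex R)) -rmorphXn /=.
  by case: (odd N); rewrite /= ?add0n ?add1n/= ?doubleK; apply/eqP;
    rewrite eq_complex/= !(mul0r, mulr0, mul1r, mulr1, subr0);
    rewrite !(addr0, add0r, oppr0) !eqxx.
rewrite exprMn iX -rmorphXn /= -(rmorph_nat (real_complex R)) -fmorphV /=.
apply/eqP; rewrite eq_complex /= !(mul0r, mulr0, subr0, addr0, add0r).
by rewrite ![_^-1 * _]mulrC !eqxx.
Qed.

Notation C := (R[i] : numFieldType).

Lemma cvg_real_complex (u : nat -> R) (l : R) :
  u @ \oo --> l -> (fun N => (u N)%:C : C) @ \oo --> (l%:C : C).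
Proof.
(* A positive element of [R[i]] has zero imaginary part, so the tolerance [e] is a positive real. *)
move=> ul; apply/cvgrPdist_lt => e; rewrite ltcE/= => /andP[/eqP e0 Re0].
have eE : e = (complex.Re e)%:C by case: (e) e0 => /= a b ->.
move/cvgrPdist_lt: ul => /(_ _ Re0); apply: filterS => N.
by rewrite -rmorphB/= normc_def/= expr0n addr0 sqrtr_sqr eE ltcR.
Qed.

Lemma cvg_expi y :
  (fun N => \sum_(k < N) (k`!%:R)^-1 * ('i * y%:C) ^+ k : C) @ \oo -->
    (expi y : C).
Proof.
rewrite [X in X @ _ --> _](_ : _ = fun N => (series (cos_coeff y) N)%:C
    + 'i * (series (sin_coeff y) N)%:C : C); last first.
  by apply/funext => N; rewrite expi_trig_series [LHS]complexE.
rewrite [expi y]complexE /=; apply: cvgDM_cst.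
- by apply: cvg_real_complex; rewrite unlock; exact: is_cvg_series_cos_coeff.
- by apply: cvg_real_complex; rewrite unlock; exact: is_cvg_series_sin_coeff.
Qed.

End Expi.

(** * Congruences, gcds and integer multiples of an angle *)

Lemma eqz_modP (x y m : int) :
  (x = y %[mod m])%Z <-> exists k : int, x = y + m * k.
Proof.
split=> [/eqP|[k ->]]; last first.
  by apply/eqP; rewrite eqz_mod_dvd addrC addKr dvdz_mulr.
rewrite eqz_mod_dvd => /dvdzP[k xyk]; exists k.
by rewrite mulrC -xyk addrC subrK.
Qed.

Lemma expi_int_comb (R : realType) (x : R) (u v k l : int) :
  expi (x * k%:~R) = 1 -> expi (x * l%:~R) = 1 ->
  expi (x * (u * k + v * l)%:~R) = 1.
Proof.
move=> xk xl; have -> : x * (u * k + v * l)%:~R =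
    x * k%:~R * u%:~R + x * l%:~R * v%:~R by rewrite intrD !intrM; ring.
by rewrite expiD !(expiMz (_ * _)) xk xl !exp1rz mulr1.
Qed.

(** The integers k with e^(i x k) = 1 are closed under integer combinations, hence under gcd by
    Bezout; the empty gcd is 0. *)
Lemma expi_gcd (R : realType) (x : R) (I : finType) (f : I -> int) :
  (forall i, expi (x * (f i)%:~R) = 1) ->
  expi (x * (\big[gcdn/0%N]_i `|f i|%N)%:Z%:~R) = 1.
Proof.
move=> xf; elim/big_ind: _ => [|k l xk xl|i _]; first by rewrite mulr0 expi0.
  have [u [v uv]] := Bezoutz k l.
  by have -> : (gcdn k l)%:Z = u * k + v * l; [rewrite uv|exact: expi_int_comb].
(* The absolute value of [f i] is its sign times [f i], written as a combination with second
   coefficient 0. *)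
by rewrite abszEsg -[X in X%:~R]addr0 -(mul0r (f i)); exact: expi_int_comb.
Qed.

Lemma scaled_gapE d (theta : 'I_d.+1 -> int) s :
  theta s = theta ord0 - scaled_gap theta s * (eigen_gcd theta)%:Z.
Proof.
rewrite /scaled_gap divzK; first by rewrite opprB addrC subrK.
(* The index [ord0] is excluded from the gcd, but its gap is 0 and so divisible. *)
have [->|s0] := eqVneq s ord0; first by rewrite subrr dvdz0.
by rewrite dvdzE; apply: (biggcdn_inf s s0).
Qed.

(** If sin x = 0 for x = t mu pi / m, then e^(2 i x) = 1, so 2 x = 2 pi k and t mu = k m. *)
Lemma revival_beta_neq0 (R : realType) (m mu t : int) :
  1 <= m -> ~ (m %| t * mu)%Z -> revival_beta R m mu t <> 0.
Proof.
move=> m1 ndvd; have m0 : m%:~R != 0 :> R by rewrite intr_eq0; lia.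
rewrite /revival_beta -complexiE => /eqP.
rewrite oppr_eq0 mulf_eq0 => /orP[/eqP[/eqP]|/eqP[]]; first by rewrite oner_eq0.
set x := _ / _ => sx; apply: ndvd.
have /expi_eq1[k xk] : expi (x *+ 2) = 1.
  rewrite /expi cos_mulr2n sin_mulr2n cos2sin2 sx expr0n subr0.
  by rewrite mulr0 mul0rn mulr2n addrK.
apply/dvdzP; exists k; apply/eqP; rewrite -(eqr_int R) !intrM; apply/eqP.
have pi0 : pi != 0 :> R by rewrite gt_eqF ?pi_gt0.
have -> : t%:~R * mu%:~R = x *+ 2 * m%:~R / (2 * pi) :> R.
  by rewrite /x; move: (pi : R) pi0 => P P0; field; rewrite P0 m0.
by rewrite xk; move: (pi : R) pi0 => P P0; field.
Qed.

(** * Fractional revival as a condition on eigenvalues *)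

Section Revival.
Variables (R : realType) (n d : nat) (A E : 'I_d.+1 -> 'M[R[i]]_n).
Variables (q : 'I_d.+1) (p : 'S_n) (sigma : 'I_d.+1 -> R[i]) (X : rel 'I_n).
Variable theta : 'I_d.+1 -> int.
Hypotheses (schemeA : assoc_scheme A) (idemE : minimal_idempotents A E).
Hypotheses (Aq : A q = perm_mx p) (ordp : #[p]%g = 2%N).
Hypotheses (Asigma : A q = \sum_s sigma s *: E s).
Hypotheses (AX : adjmx R[i] X = \sum_s (theta s)%:~R *: E s).

Lemma walk_spectral (t : R) :
  walk (adjmx R[i] X) t = \sum_s expi (- (t * (theta s)%:~R)) *: E s.
Proof.
rewrite /walk AX scaler_sumr.
under [X in expmx X]eq_bigr do rewrite scalerA.
apply: (expmx_spectral schemeA idemE) => s.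
have -> : - ('i * t%:C%C) * (theta s)%:~R =
    'i%C * (- (t * (theta s)%:~R))%:C%C :> R[i].
  by rewrite -complexiE rmorphN rmorphM/= rmorph_int; ring.
exact: cvg_expi.
Qed.

(** Since [A q] sends e_a to e_b, the right-hand side is column [a] of a matrix of the algebra, so
    the columns agree only if all eigenvalues do. *)
Lemma walk_revivalP (a b : 'I_n) (t zeta : R) (alpha beta : R[i]) :
  A q a b = 1 ->
  walk (adjmx R[i] X) t *m basis_vec R a =
    expi zeta *: (alpha *: basis_vec R a + beta *: basis_vec R b) <->
  forall s, expi (- (t * (theta s)%:~R)) = expi zeta * (alpha + beta * sigma s).
Proof.
move=> Aqab; set rhs := RHS.
have -> : rhs = (\sum_s (expi zeta * (alpha + beta * sigma s)) *: E s) *m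
    delta_mx a ord0.
  rewrite /rhs /basis_vec -(perm_class_basis schemeA Aq Aqab).
  under [in RHS]eq_bigr do rewrite -scalerA scalerDl -[(beta * _) *: _]scalerA.
  rewrite -scaler_sumr big_split/= -!scaler_sumr (sum_min_idems schemeA idemE).
  by rewrite -Asigma -scalemxAl mulmxDl -!scalemxAl mul1mx.
rewrite walk_spectral; split=> eqs.
  exact: (sum_min_idems_col schemeA idemE eqs).
by congr (_ *m _); apply: eq_bigr => s _; rewrite eqs.
Qed.

Hypothesis g0 : eigen_gcd theta <> 0%N.

Let gap_pos : (eigen_gcd theta)%:R != 0 :> R.
Proof. by rewrite pnatr_eq0; exact/eqP. Qed.

Lemma revival_sufficient (m mu t : int) (a b : 'I_n) :
  1 <= m -> cond_i theta sigma m mu -> cond_ii theta sigma m -> A q a b = 1 ->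
  revival (adjmx R[i] X) (revival_time R (eigen_gcd theta) m t)
    (revival_zeta R (eigen_gcd theta) (theta ord0) m mu t)
    (revival_alpha R m mu t) (revival_beta R m mu t) a b.
Proof.
move=> m1 Ci Cii Aqab; have m0 : m%:~R != 0 :> R by rewrite intr_eq0; lia.
set x : R := t%:~R * mu%:~R * pi / m%:~R.
split; last first.
  rewrite /revival_alpha /revival_beta -/x normrN normrM -complexiE.
  rewrite !normc_def /= !(expr0n, expr1n, addr0, add0r) /=.
  rewrite sqrtr1 !sqrtr_sqr mul1r -!rmorphXn -rmorphD /=.
  by rewrite !real_normK ?num_real// cos2Dsin2.
apply/walk_revivalP => // s.
(* The factor alpha + beta sigma_s is e^(- i x) where sigma_s = 1 and e^(i x) where sigma_s = -1. *)
have albe1 : revival_alpha R m mu t + revival_beta R m mu t = expi (- x).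
  rewrite /revival_alpha /revival_beta -/x -complexiE /expi cosN sinN.
  apply/eqP; rewrite eq_complex /= !(mul0r, mul1r, mulr0, addr0, add0r).
  by rewrite !(oppr0, subr0) !eqxx.
have albeN1 : revival_alpha R m mu t - revival_beta R m mu t = expi x.
  rewrite /revival_alpha /revival_beta -/x -complexiE /expi.
  apply/eqP; rewrite eq_complex /= !(mul0r, mul1r, mulr0, addr0, add0r).
  by rewrite !(oppr0, subr0, opprK) ?addr0 ?add0r !eqxx.
have := scaled_gapE theta s; move: (scaled_gap theta s) (Ci s) (Cii s) => ga.
move=> Cis Ciis ->; rewrite intrB intrM.
have [s1|s1] := sigma_pm1 schemeA idemE Aq ordp Asigma s; rewrite s1.
  have /eqz_modP[k ->] := Ciis s1; rewrite mulr1 albe1 -expiD.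
  (* The phases differ by 2 pi t k, where k is the quotient in the congruence modulo [m]. *)
  have -> : - (revival_time R (eigen_gcd theta) m t *
      ((theta ord0)%:~R - (0 + m * k)%:~R * (eigen_gcd theta)%:Z%:~R)) =
    revival_zeta R (eigen_gcd theta) (theta ord0) m mu t - x
      + 2 * pi * (t * k)%:~R.
    rewrite /revival_time /revival_zeta /x add0r !intrM -!pmulrn; field.
    by rewrite gap_pos m0.
  by rewrite expiD expiMz expi2pi exp1rz mulr1.
have /eqz_modP[k ->] := Cis s1; rewrite mulrN1 albeN1 -expiD.
have -> : - (revival_time R (eigen_gcd theta) m t *
    ((theta ord0)%:~R - (mu + m * k)%:~R * (eigen_gcd theta)%:Z%:~R)) =
  revival_zeta R (eigen_gcd theta) (theta ord0) m mu t + x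
    + 2 * pi * (t * k)%:~R.
  rewrite /revival_time /revival_zeta /x intrD !intrM -!pmulrn; field.
  by rewrite gap_pos m0.
by rewrite expiD expiMz expi2pi exp1rz mulr1.
Qed.

Lemma two_gap_adjmx (a : 'I_n) (mu : int) :
  irreflexive X -> mu != 0 ->
  (forall s, scaled_gap theta s = if sigma s == 1 then 0 else mu) ->
  adjmx R[i] X = A q.
Proof.
move=> irrX mu0 gap; pose g := eigen_gcd theta.
(* Solves x + y = theta_0 and x - y = theta_0 - mu g, the eigenvalues of the graph where sigma_s is
   1 and -1. *)
pose y : R[i] := (mu * g%:Z)%:~R / 2.
apply: (affine_perm_class schemeA idemE Aq ordp a (x := (theta ord0)%:~R - y)
  (y := y) irrX); last first.
  rewrite mulf_neq0 ?invr_eq0 ?pnatr_eq0// intr_eq0 mulf_neq0//.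
  by apply/eqP => -[].
rewrite AX Asigma -(sum_min_idems schemeA idemE) !scaler_sumr -big_split/=.
apply: eq_bigr => s _; rewrite scalerA -scalerDl scaled_gapE gap.
congr (_ *: _).
have neq : (-1 == 1 :> R[i]) = false by rewrite eqNr oner_eq0.
rewrite /y; have [->|->] := sigma_pm1 schemeA idemE Aq ordp Asigma s.
  by rewrite eqxx mul0r subr0 mulr1 subrK.
by rewrite neq intrB mulrN1; field.
Qed.

Lemma revival_necessary (tau zeta : R) (alpha beta : R[i]) (a b : 'I_n) :
  irreflexive X -> A q a b = 1 ->
  fractional_revival (adjmx R[i] X) tau zeta alpha beta a b ->
  exists m mu : int,
    [/\ 1 <= m, cond_i theta sigma m mu, cond_ii theta sigma m, ~ (m %| mu)%Z
      & adjmx R[i] X <> A q ->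
        exists t : int, tau = revival_time R (eigen_gcd theta) m t].
Proof.
move=> irrX Aqab [_ [walkab _] beta0].
have {walkab}U := (walk_revivalP _ _ _ _ Aqab).1 walkab.
have sigmaP := sigma_pm1 schemeA idemE Aq ordp Asigma.
have sigma01 := sigma0 schemeA idemE Aq Asigma a.
have [r sr] := sigma_neg schemeA idemE Aq ordp Asigma.
have neq : (-1 == 1 :> R[i]) = false by rewrite eqNr oner_eq0.
pose g := eigen_gcd theta; pose ga := scaled_gap theta; pose mu := ga r.
have gN0 : g%:R != 0 :> R by rewrite pnatr_eq0; exact/eqP.
pose phi : R := tau * g%:R.
have phiE s s' : expi (- (tau * (theta s)%:~R)) =
    expi (- (tau * (theta s')%:~R)) * expi (phi * (ga s - ga s')%:~R).
  rewrite -expiD (scaled_gapE theta s) (scaled_gapE theta s') -/ga -/g.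
  by congr expi; rewrite /phi !intrB !intrM -!pmulrn; ring.
(* By [U], the eigenvalue of the walk on [E s] depends on [s] only through [sigma s]. *)
have ga_eq s s' : sigma s = sigma s' -> expi (phi * (ga s - ga s')%:~R) = 1.
  move=> ss'; apply: (mulfI (expi_neq0 (- (tau * (theta s')%:~R)))).
  by rewrite -phiE mulr1 !U ss'.
have ga0 : ga ord0 = 0 by rewrite /ga /scaled_gap subrr div0z.
(* Otherwise the walk has the same eigenvalue on [E r] and [E ord0], so beta = - beta. *)
have phimu : expi (phi * mu%:~R) <> 1.
  move=> mu1; have := phiE r ord0; rewrite ga0 subr0 mu1 mulr1 !U sr sigma01.
  move/(mulfI (expi_neq0 zeta))/addrI/eqP; rewrite mulr1 mulrN1.
  by rewrite eqNr => /eqP.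
(* Conditions (i) and (ii) modulo m say exactly that m divides every [delta s]; [M] is the largest
   such modulus unless all of them vanish. *)
pose delta s := if sigma s == 1 then ga s else ga s - mu.
have delta1 s : expi (phi * (delta s)%:~R) = 1.
  rewrite /delta; have [s1|s1] := sigmaP s; rewrite s1 ?eqxx ?neq.
    by rewrite -[ga s]subr0 -ga0; apply: ga_eq; rewrite s1 sigma01.
  by apply: ga_eq; rewrite s1 sr.
pose M := (\big[gcdn/0%N]_s `|delta s|%N).
have phiM : expi (phi * M%:Z%:~R) = 1 by exact: expi_gcd.
have Mdelta s : (M%:Z %| delta s)%Z.
  by rewrite dvdzE; apply: (biggcdn_inf s isT).
have [M0|M0] := eqVneq M 0%N.
  have d0 s : delta s = 0.
    by apply/eqP; rewrite -dvd0z; have := Mdelta s; rewrite M0.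
  have mu0 : mu != 0.
    by apply/eqP => mu0; apply: phimu; rewrite mu0 mulr0 expi0.
  have gaE s : ga s = if sigma s == 1 then 0 else mu.
    have := d0 s; rewrite /delta; case: ifP => // _ /eqP.
    by rewrite subr_eq0 => /eqP.
  (* The congruences are equalities here, so any modulus satisfies them; this one exceeds the
     absolute value of the nonzero [mu] and cannot divide it. *)
  exists (`|mu|%N%:Z + 1), mu; split.
  - by rewrite lerDr.
  - by move=> s s1; rewrite -/ga gaE s1 neq.
  - by move=> s s1; rewrite -/ga gaE s1 eqxx.
  - by rewrite dvdzE => /dvdn_leq; lia.
  - by case; exact: (two_gap_adjmx a irrX mu0 gaE).
exists M%:Z, mu; split.
- by rewrite lez_nat lt0n.
- move=> s s1; apply/eqP; rewrite eqz_mod_dvd; have := Mdelta s.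
  by rewrite /delta s1 neq.
- move=> s s1; apply/eqP; rewrite eqz_mod_dvd subr0; have := Mdelta s.
  by rewrite /delta s1 eqxx.
(* A multiple [mu] of [M] would inherit e^(i phi mu) = 1 from [phiM]. *)
- move=> /dvdzP[k muk]; apply: phimu.
  rewrite muk -[k * _]addr0 -(mul0r 0).
  by apply: expi_int_comb; rewrite ?mulr0 ?expi0.
(* From phi M = 2 pi k and phi = tau g follows tau = 2 k pi / (M g). *)
- move=> _; have [k phik] := expi_eq1 phiM; exists k.
  have MN0 : M%:R != 0 :> R by rewrite pnatr_eq0.
  have -> : tau = phi * M%:R / (M%:R * g%:R).
    by rewrite /phi; field; rewrite MN0 gN0.
  by rewrite phik /revival_time -pmulrn; ring.
Qed.

End Revival.

Theorem theorem3p3 (R : realType) (n d : nat)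
    (A E : 'I_d.+1 -> 'M[R[i]]_n) (q : 'I_d.+1) (p : 'S_n)
    (sigma : 'I_d.+1 -> R[i]) (X : rel 'I_n) (theta : 'I_d.+1 -> int) :
  assoc_scheme A ->
  minimal_idempotents A E ->
  A q = perm_mx p ->
  #[p]%g = 2%N ->
  A q = \sum_s sigma s *: E s ->
  simple_graph X ->
  graph_in_scheme A X ->
  adjmx R[i] X = \sum_s (theta s)%:~R *: E s ->
  (forall r s : 'I_d.+1, (r <= s)%N -> theta s <= theta r) ->
  let g := eigen_gcd theta in
  g <> 0%N ->
  (forall m mu : int, 1 <= m ->
     cond_i theta sigma m mu -> cond_ii theta sigma m ->
     forall (t : int) (a b : 'I_n), A q a b = 1 ->
       let tau := revival_time R g m t in
       let zeta := revival_zeta R g (theta ord0) m mu t in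
       let alpha := revival_alpha R m mu t in
       let beta := revival_beta R m mu t in
       revival (adjmx R[i] X) tau zeta alpha beta a b /\
       (~ (m %| t * mu)%Z ->
        fractional_revival (adjmx R[i] X) tau zeta alpha beta a b)) /\
  (forall (tau zeta : R) (alpha beta : R[i]) (a b : 'I_n), A q a b = 1 ->
     fractional_revival (adjmx R[i] X) tau zeta alpha beta a b ->
     exists m mu : int,
       [/\ 1 <= m, cond_i theta sigma m mu, cond_ii theta sigma m,
           ~ (m %| mu)%Z
         & adjmx R[i] X <> A q ->
           exists t : int, tau = revival_time R g m t]).
Proof.
move=> schemeA idemE Aq ordp Asigma [_ irrX] _ AX _ g g0; split; last first.
  move=> tau zeta alpha beta a b.
  exact: (revival_necessary schemeA idemE Aq ordp Asigma AX g0 irrX).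
move=> m mu m1 Ci Cii t a b Aqab tau zeta alpha beta.
have rev : revival (adjmx R[i] X) tau zeta alpha beta a b.
  exact: (revival_sufficient schemeA idemE Aq ordp Asigma AX g0).
split=> // ndvd; split=> [ab||] //; last exact: (revival_beta_neq0 m1 ndvd).
(* The vertices differ because [A q] has zero diagonal. *)
by move: Aqab; rewrite ab (perm_class_diag schemeA Aq ordp) => /esym/eqP;
  rewrite oner_eq0.
Qed.
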